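(* Let $G$ be the subgroup of $VB_n$ generated by the elements $\lambda_{s,t}\lambda_{t,s}^{-1}$ ($1\le s<t\le n$); $\lambda_{t,s}^2$ ($1\le s<t\le n$); $\lambda_{t,s}\lambda_{r,q}\lambda_{t,s}^{-1}\lambda_{r,q}^{-1}$ ($1\le s<t\le n$, $1\le q<r\le n$, $(t-r)(t-q)(s-r)(s-q)>0$); $\lambda_{t,s}\lambda_{s,r}\lambda_{t,s}^{-1}\lambda_{t,r}^{-1}$ ($n\ge t>s>r\ge1$); $\lambda_{t,s}\lambda_{s,r}\lambda_{t,r}^{-1}\lambda_{s,r}^{-1}$ ($n\ge t>s>r\ge1$). Then the normal closure of $G$ in $VP_n$ coincides with $VP_n\cap H_n$.
   Context: The virtual braid group $VB_n$ has generators $\sigma_1,\dots,\sigma_{n-1},\rho_1,\dots,\rho_{n-1}$ and relations $\sigma_i\sigma_j=\sigma_j\sigma_i$, $\rho_i\rho_j=\rho_j\rho_i$, $\sigma_i\rho_j=\rho_j\sigma_i$ for $|i-j|\ge2$; $\sigma_i\sigma_{i+1}\sigma_i=\sigma_{i+1}\sigma_i\sigma_{i+1}$; $\rho_i\rho_{i+1}\rho_i=\rho_{i+1}\rho_i\rho_{i+1}$; $\rho_i^2=1$; $\rho_i\rho_{i+1}\sigma_i=\sigma_{i+1}\rho_i\rho_{i+1}$. Let $\iota_1:VB_n\to S_n$ send $\sigma_i,\rho_i\mapsto(i,i+1)$ and $\iota_2:VB_n\to S_n$ send $\sigma_i\mapsto1$, $\rho_i\mapsto(i,i+1)$; $VP_n=\ker\iota_1$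 (virtual pure braid group) and $H_n=\ker\iota_2$ (Rabenda group). Define $\lambda_{i,i+1}=\rho_i\sigma_i^{-1}$, $\lambda_{i+1,i}=\sigma_i^{-1}\rho_i$, and for $1\le i<j-1\le n-1$: $\lambda_{i,j}=\rho_{j-1}\rho_{j-2}\cdots\rho_{i+1}\lambda_{i,i+1}\rho_{i+1}\cdots\rho_{j-2}\rho_{j-1}$ and $\lambda_{j,i}=\rho_{j-1}\rho_{j-2}\cdots\rho_{i+1}\lambda_{i+1,i}\rho_{i+1}\cdots\rho_{j-2}\rho_{j-1}$. These elements lie in $VP_n$. *)

(* Defs.v *)
(* The virtual braid group VB_n is presented as words in the
   letters sigma_i^{+-1}, rho_i^{+-1} (1 <= i <= n-1, 1-based as in the paper)
   modulo the congruence generated by free cancellation and the defining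
   relations. *)
From mathcomp Require Import all_boot all_algebra all_fingroup.
Set Implicit Arguments. Unset Strict Implicit. Unset Printing Implicit Defensive.

(* A letter: [is_rho] (false = sigma, true = rho), 1-based index, sign
   (true = exponent +1, false = exponent -1). *)
Record letter := Letter { is_rho : bool; idx : nat; pos : bool }.
Definition word := seq letter.

Definition sig (i : nat) : letter := Letter false i true.
Definition sigi (i : nat) : letter := Letter false i false.
Definition rho (i : nat) : letter := Letter true i true.
Definition rhoi (i : nat) : letter := Letter true i false.

Definition flip (l : letter) : letter := Letter (is_rho l) (idx l) (~~ pos l).
Definition winv (w : word) : word := rev (map flip w).

Definition valid_letter (n : nat) (l : letter) : bool := (0 < idx l) && (idx l < n).
Definition valid_word (n : nat) (w : word) : bool := all (valid_letter n) w.

Inductive vb_base (n : nat) : word -> word -> Prop :=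
| vb_cancel (l : letter) : valid_letter n l -> vb_base n [:: l; flip l] [::]
| vb_ss i j : 0 < i < n -> 0 < j < n -> i + 2 <= j \/ j + 2 <= i ->
    vb_base n [:: sig i; sig j] [:: sig j; sig i]
| vb_rr i j : 0 < i < n -> 0 < j < n -> i + 2 <= j \/ j + 2 <= i ->
    vb_base n [:: rho i; rho j] [:: rho j; rho i]
| vb_sr i j : 0 < i < n -> 0 < j < n -> i + 2 <= j \/ j + 2 <= i ->
    vb_base n [:: sig i; rho j] [:: rho j; sig i]
| vb_sss i : 0 < i -> i.+1 < n ->
    vb_base n [:: sig i; sig i.+1; sig i] [:: sig i.+1; sig i; sig i.+1]
| vb_rrr i : 0 < i -> i.+1 < n ->
    vb_base n [:: rho i; rho i.+1; rho i] [:: rho i.+1; rho i; rho i.+1]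
| vb_rr1 i : 0 < i < n -> vb_base n [:: rho i; rho i] [::]
| vb_rrs i : 0 < i -> i.+1 < n ->
    vb_base n [:: rho i; rho i.+1; sig i] [:: sig i.+1; rho i; rho i.+1].

Inductive vb_eq (n : nat) : word -> word -> Prop :=
| vbe_step u x y v : vb_base n x y -> vb_eq n (u ++ x ++ v) (u ++ y ++ v)
| vbe_refl w : vb_eq n w w
| vbe_sym u v : vb_eq n u v -> vb_eq n v u
| vbe_trans u v w : vb_eq n u v -> vb_eq n v w -> vb_eq n u w.

(* The adjacent transposition (i, i+1) in S_n (1-based i, i.e. 0-based
   points i-1 and i of 'I_n). *)
Definition adj_tr (n i : nat) : {perm 'I_n} :=
  match n as k return {perm 'I_k} with
  | 0 => 1%g
  | m.+1 => tperm (@inord m i.-1) (@inord m i)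
  end.

Definition iota1_letter (n : nat) (l : letter) : {perm 'I_n} :=
  if pos l then adj_tr n (idx l) else ((adj_tr n (idx l))^-1)%g.
Definition iota1 (n : nat) (w : word) : {perm 'I_n} :=
  (\prod_(l <- w) iota1_letter n l)%g.

Definition iota2_letter (n : nat) (l : letter) : {perm 'I_n} :=
  if is_rho l then iota1_letter n l else 1%g.
Definition iota2 (n : nat) (w : word) : {perm 'I_n} :=
  (\prod_(l <- w) iota2_letter n l)%g.

Definition in_VP (n : nat) (w : word) : Prop := valid_word n w /\ iota1 n w = 1%g.
Definition in_H (n : nat) (w : word) : Prop := valid_word n w /\ iota2 n w = 1%g.

Definition rho_chain (i j : nat) : word := map rho (rev (iota i.+1 (j.-1 - i))).

(* lambda_{a,b} for a <> b *)
Definition lambda (a b : nat) : word :=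
  if a < b then rho_chain a b ++ [:: rho a; sigi a] ++ winv (rho_chain a b)
  else rho_chain b a ++ [:: sigi b; rho b] ++ winv (rho_chain b a).

Inductive G_gen (n : nat) : word -> Prop :=
| G1 s t : 1 <= s -> s < t -> t <= n ->
    G_gen n (lambda s t ++ winv (lambda t s))
| G2 s t : 1 <= s -> s < t -> t <= n ->
    G_gen n (lambda t s ++ lambda t s)
| G3 s t q r : 1 <= s -> s < t -> t <= n -> 1 <= q -> q < r -> r <= n ->
    (0 < (t%:Z - r%:Z) * (t%:Z - q%:Z) * (s%:Z - r%:Z) * (s%:Z - q%:Z))%R ->
    G_gen n (lambda t s ++ lambda r q ++ winv (lambda t s) ++ winv (lambda r q))
| G4 t s r : 1 <= r -> r < s -> s < t -> t <= n ->
    G_gen n (lambda t s ++ lambda s r ++ winv (lambda t s) ++ winv (lambda t r))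
| G5 t s r : 1 <= r -> r < s -> s < t -> t <= n ->
    G_gen n (lambda t s ++ lambda s r ++ winv (lambda t r) ++ winv (lambda s r)).

Inductive ncl_G (n : nat) : word -> Prop :=
| ncl_gen g : G_gen n g -> ncl_G n g
| ncl_one : ncl_G n [::]
| ncl_mul u v : ncl_G n u -> ncl_G n v -> ncl_G n (u ++ v)
| ncl_inv u : ncl_G n u -> ncl_G n (winv u)
| ncl_conj x u : in_VP n x -> ncl_G n u -> ncl_G n (x ++ u ++ winv x)
| ncl_eq u v : vb_eq n u v -> ncl_G n u -> ncl_G n v.

(* Main.v *)
(* Every w in VB_n can be written x r with x a product of elements lambda_{a,b}^{+-1}
   and r a word in the rho_i: replace each sigma_i^{+-1} by lambda^{-+1} rho_i and
   move the rho's to the right, conjugation by rho_k permuting the lambda_{a,b}. If w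
   lies in VP_n, then r maps to 1 in S_n, so r = 1 by the Coxeter presentation of
   S_n. Modulo the normal closure of G, each lambda_{a,b}^{+-1} is a product of the
   elements l_i = lambda_{i+1,i}, and these satisfy the Coxeter relations; hence x
   is congruent to a word in the l_i, whose image under iota_2 is the permutation it
   spells. If w lies in H_n this permutation is 1, so x is trivial modulo the
   normal closure, again by the Coxeter presentation. *)
Require Import Defs.
From Stdlib Require Import Setoid Morphisms.
From mathcomp Require Import all_boot all_algebra all_fingroup.
From mathcomp Require Import zify.
Set Implicit Arguments. Unset Strict Implicit. Unset Printing Implicit Defensive.

(** * Adjacent transpositions in the symmetric group *)

Definition transp (n a b : nat) : {perm 'I_n.+1} :=
  tperm (inord a.-1) (inord b.-1).

Lemma adj_trE n i : adj_tr n.+1 i = transp n i i.+1.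
Proof. by []. Qed.

Lemma inord_eq n a b : a <= n -> b <= n ->
  ((inord a : 'I_n.+1) == inord b) = (a == b).
Proof. by move=> an bn; rewrite -val_eqE /= !inordK. Qed.

Lemma transpJ n a b c : 0 < a <= n.+1 -> 0 < b <= n.+1 -> 0 < c <= n.+1 ->
  a != b -> a != c -> (transp n a b ^ transp n b c = transp n a c)%g.
Proof.
move=> an bn cn ab ac; rewrite /transp tpermJ tpermL tpermD //;
  rewrite inord_eq; lia.
Qed.

Lemma adj_tr_sqr n i : (adj_tr n i * adj_tr n i = 1)%g.
Proof. by case: n => [|n] /=; [rewrite mulg1 | rewrite tperm2]. Qed.

Lemma adj_trV n i : ((adj_tr n i)^-1 = adj_tr n i)%g.
Proof. by apply/eqP; rewrite eq_invg_mul adj_tr_sqr. Qed.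

Lemma adj_tr_comm n i j : 0 < i -> i.+1 < j -> j < n ->
  (adj_tr n i * adj_tr n j = adj_tr n j * adj_tr n i)%g.
Proof.
case: n => [|n] // i0 ij jn; rewrite !adj_trE [RHS]conjgC tpermJ.
by rewrite !tpermD // inord_eq; lia.
Qed.

Lemma adj_tr_braid n i : 0 < i -> i.+1 < n ->
  (adj_tr n i * adj_tr n i.+1 * adj_tr n i =
  adj_tr n i.+1 * adj_tr n i * adj_tr n i.+1)%g.
Proof.
case: n => [|n] // i0 iin.
have E x y : (adj_tr n.+1 x * y * adj_tr n.+1 x = y ^ adj_tr n.+1 x)%g.
  by rewrite conjgE adj_trV mulgA.
rewrite !E !adj_trE [RHS]transpJ; try lia.
by rewrite /transp tpermJ tpermR tpermD // inord_eq; lia.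
Qed.

(** * The Coxeter presentation of the symmetric group *)

Inductive cox_eq (n : nat) : seq nat -> seq nat -> Prop :=
| cox_refl s : cox_eq n s s
| cox_sym s t : cox_eq n s t -> cox_eq n t s
| cox_trans s t u : cox_eq n s t -> cox_eq n t u -> cox_eq n s u
| cox_cat s t s' t' : cox_eq n s t -> cox_eq n s' t' ->
    cox_eq n (s ++ s') (t ++ t')
| cox_sqr i : 0 < i < n -> cox_eq n [:: i; i] [::]
| cox_comm i j : 0 < i -> i.+1 < j -> j < n -> cox_eq n [:: i; j] [:: j; i]
| cox_braid i : 0 < i -> i.+1 < n ->
    cox_eq n [:: i; i.+1; i] [:: i.+1; i; i.+1].

#[local] Instance cox_eq_equiv n : Equivalence (cox_eq n).
Proof. by split=> [s|s t|s t u]; [apply: cox_refl|apply: cox_sym|apply: cox_trans]. Qed.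

#[local] Instance cox_eq_cat n :
  Proper (cox_eq n ==> cox_eq n ==> cox_eq n) (@cat nat).
Proof. by move=> s t st s' t'; apply: cox_cat. Qed.

Definition adj_prod (n : nat) (s : seq nat) : {perm 'I_n} :=
  (\prod_(i <- s) adj_tr n i)%g.

Lemma adj_prod_cat n s t : (adj_prod n (s ++ t) = adj_prod n s * adj_prod n t)%g.
Proof. exact: big_cat. Qed.

Lemma cox_eq_adj_prod n s t : cox_eq n s t -> adj_prod n s = adj_prod n t.
Proof.
elim=> {s t} //.
- by move=> s t u _ -> _ ->.
- by move=> s t s' t' _ IH _ IH'; rewrite !adj_prod_cat IH IH'.
- by move=> i _; rewrite /adj_prod !big_cons !big_nil mulg1 adj_tr_sqr.
- by move=> i j *; rewrite /adj_prod !big_cons !big_nil !mulg1 adj_tr_comm.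
- by move=> i *; rewrite /adj_prod !big_cons !big_nil !mulg1 !mulgA adj_tr_braid.
Qed.

(** The Coxeter generators are involutions, so words without inverse letters in [1, ..., m-1]
    represent every element of S_m. *)
Definition gen_below (m : nat) (s : seq nat) := all (fun i => 0 < i < m) s.

Lemma cox_commute n c j : gen_below n c -> 0 < j < n ->
  all (fun i => (i.+1 < j) || (j.+1 < i)) c -> cox_eq n (c ++ [:: j]) (j :: c).
Proof.
move=> + jn; elim: c => [|i c IH] /= => [_ _|/andP[iv cv] /andP[ij cj]].
  exact: cox_refl.
rewrite -cat1s IH // -[[:: i] ++ _]/([:: i; j] ++ c) -[j :: i :: c]/([:: j; i] ++ c).
apply: cox_cat; last exact: cox_refl.
by case/orP: ij => ij; [|apply: cox_sym]; apply: cox_comm; lia.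
Qed.

(* The word [m; m-1; ...; k], empty when k = m + 1. *)
Definition descent (m k : nat) : seq nat := rev (iota k (m.+1 - k)).

Lemma descent_nil m : descent m m.+1 = [::].
Proof. by rewrite /descent subnn. Qed.

Lemma descent_split m j k : k <= j.+1 <= m.+1 ->
  descent m k = descent m j.+1 ++ descent j k.
Proof.
move=> jk; rewrite /descent -rev_cat.
rewrite [in iota j.+1 _](_ : j.+1 = k + (j.+1 - k)); last lia.
by rewrite -iotaD; congr (rev (iota _ _)); lia.
Qed.

Lemma descent1 m : descent m m = [:: m].
Proof. by rewrite /descent subSnn. Qed.

Lemma mem_descent m k i : (i \in descent m k) = (k <= i <= m).
Proof. by rewrite mem_rev mem_iota; lia. Qed.

(* The descents from m are right coset representatives of S_m in S_(m+1). *)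
Lemma cox_descent_rcons n m k j : m < n -> 0 < k <= m.+1 -> 0 < j <= m ->
  exists s k', [/\ gen_below m s, 0 < k' <= m.+1 &
    cox_eq n (descent m k ++ [:: j]) (s ++ descent m k')].
Proof.
move=> mn km jm.
have below a b : b < n -> 0 < a -> gen_below n (descent b a).
  by move=> bn a0; apply/allP => i; rewrite mem_descent; lia.
have [jk|kj|jk] := ltngtP j k; last 1 first.
(* If j = k, the new letter cancels the last letter of the descent. *)
- exists [::], k.+1; split=> //; first lia.
  rewrite (@descent_split m k k); last lia.
  rewrite -catA jk descent1 -[X in cox_eq _ _ X]cats0.
  apply: cox_cat; [exact: cox_refl | apply: cox_sqr; lia].
(* If j < k, the new letter either prolongs the descent by one step (j + 1 = k) or commutes with all
   of it. *)
- have [jk1|jk1] := eqVneq j.+1 k.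
    exists [::], j; split=> //; first lia.
    rewrite [descent m j](@descent_split m j j); last lia.
    by rewrite descent1 jk1; apply: cox_refl.
  exists [:: j], k; split=> //; first by rewrite /gen_below /=; lia.
  apply: cox_commute; [by apply: below; lia|lia|].
  by apply/allP => i; rewrite mem_descent; lia.
(* If k < j, write [j.+1] for the new letter. It commutes left past j-1, ..., k; the braid relation
   turns j+1, j, j+1 into j, j+1, j; the first j then commutes left past m, ..., j+2. The descent
   reappears unchanged behind the single letter j. *)
case: j jm kj => [|j] // jm kj.
exists [:: j], k; split=> //; first by rewrite /gen_below /=; lia.
have -> : descent m k = descent m j.+2 ++ [:: j.+1; j] ++ descent j.-1 k.
  rewrite (@descent_split m j.+1 k); last lia.
  rewrite (@descent_split j.+1 j k); last lia.
  rewrite [descent j k](@descent_split j j.-1 k); last lia.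
  by rewrite (prednK (_ : 0 < j)) ?descent1 //; lia.
have low : cox_eq n (descent j.-1 k ++ [:: j.+1]) (j.+1 :: descent j.-1 k).
  apply: cox_commute; [by apply: below; lia|lia|].
  by apply/allP => i; rewrite mem_descent; lia.
have high : cox_eq n (descent m j.+2 ++ [:: j]) (j :: descent m j.+2).
  apply: cox_commute; [by apply: below; lia|lia|].
  by apply/allP => i; rewrite mem_descent; lia.
rewrite -!catA low -[[:: j.+1; j] ++ _]/([:: j.+1; j; j.+1] ++ descent j.-1 k).
rewrite -(@cox_braid n j); [|lia|lia].
rewrite -[[:: j; j.+1; j] ++ _]/([:: j] ++ [:: j.+1; j] ++ descent j.-1 k).
rewrite catA high /=; exact: cox_refl.
Qed.

(** Reading the word letter by letter, each new letter only changes the coset representative and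
    leaves a factor from the smaller group on its left. *)
Lemma cox_factor n m s : m < n -> gen_below m.+1 s ->
  exists t k, [/\ gen_below m t, 0 < k <= m.+1 & cox_eq n s (t ++ descent m k)].
Proof.
move=> mn; elim/last_ind: s => [|s j IH].
  by exists [::], m.+1; rewrite descent_nil; split; rewrite ?leqnn //; apply: cox_refl.
rewrite /gen_below all_rcons => /andP[jm /IH[t [k [tm km st]]]].
have [||t' [k' [tm' km' E]]] := @cox_descent_rcons n m k j mn; [lia|lia|].
exists (t ++ t'), k'; split=> //; first by rewrite /gen_below all_cat; apply/andP.
by rewrite -cats1 st -!catA E; apply: cox_refl.
Qed.

Lemma adj_prod_fix n m s : m <= n -> gen_below m s ->
  adj_prod n.+1 s (inord m) = inord m.
Proof.
move=> mn; elim: s => [|i s IH] /=; first by rewrite /adj_prod big_nil perm1.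
case/andP=> im sm; rewrite /adj_prod big_cons permM -/(adj_prod _ _).
by rewrite adj_trE /transp tpermD ?IH // inord_eq; lia.
Qed.

(** Products of permutations act from left to right, so the letters m, m-1, ..., k lower the last
    point one step at a time. Its image thus determines k and tells the coset representatives
    apart. *)
Lemma adj_prod_descent n m k : m <= n -> 0 < k <= m.+1 ->
  adj_prod n.+1 (descent m k) (inord m) = inord k.-1.
Proof.
move=> mn; elim: m => [|m IH] in mn * => km.
  have -> : k = 1 by lia.
  by rewrite descent_nil /adj_prod big_nil perm1.
have [->|km1] := eqVneq k m.+2; first by rewrite descent_nil /adj_prod big_nil perm1.
rewrite (@descent_split m.+1 m k); last lia.
rewrite adj_prod_cat permM descent1 /adj_prod big_seq1 adj_trE /transp /= tpermR.
by apply: IH; lia.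
Qed.

(** Faithfulness of the presentation: a trivial permutation fixes the last point, which forces the
    descent in [cox_factor] to be empty and leaves a word in fewer generators. *)
Lemma coxeter_presentation n s : gen_below n s -> adj_prod n s = 1%g ->
  cox_eq n s [::].
Proof.
case: n => [|n]; first by case: s => [|i s] //= *; [exact: cox_refl | lia].
(* The ambient group stays fixed; the induction is on the range of the letters that occur. *)
suff H m : m <= n -> gen_below m.+1 s -> adj_prod n.+1 s = 1%g -> cox_eq n.+1 s [::].
  exact: H.
elim: m s => [|m IH] s mn.
  case: s => [|i s]; [by move=> *; exact: cox_refl | rewrite /gen_below /=; lia].
case/(@cox_factor n.+1 m.+1)=> [|t [k [tm km st]]]; first lia.
rewrite (cox_eq_adj_prod st) adj_prod_cat => E.
(* The word fixes the last point, so its coset representative is trivial. *)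
have kE : k = m.+2.
  have := congr1 (fun p : {perm _} => p (inord m.+1)) E.
  rewrite permM adj_prod_fix // adj_prod_descent // perm1 => /eqP.
  by rewrite inord_eq; lia.
move: E; rewrite st kE descent_nil cats0 {2}/adj_prod big_nil mulg1 => E.
exact: IH (ltnW mn) tm E.
Qed.

(** * Calculation with words in VB_n *)

#[local] Instance vb_eq_equiv n : Equivalence (vb_eq n).
Proof. by split=> [w|u v|u v w]; [apply: vbe_refl|apply: vbe_sym|apply: vbe_trans]. Qed.

Lemma vb_eq_ctx n u x y v : vb_eq n x y -> vb_eq n (u ++ x ++ v) (u ++ y ++ v).
Proof.
elim=> [u' x' y' v' xy|w|x' y' _ IH|x' y' z' _ IH1 _ IH2].
- have E z : u ++ (u' ++ z ++ v') ++ v = (u ++ u') ++ z ++ (v' ++ v).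
    by rewrite -!catA.
  by rewrite !E; apply: vbe_step.
- exact: vbe_refl.
- exact: vbe_sym.
- exact: vbe_trans IH1 IH2.
Qed.

#[local] Instance vb_eq_cat n : Proper (vb_eq n ==> vb_eq n ==> vb_eq n) (@cat letter).
Proof.
move=> x y xy x' y' xy'; apply: (@vbe_trans _ _ (x ++ y')).
  by have := vb_eq_ctx x [::] xy'; rewrite !cats0.
exact: (vb_eq_ctx [::] y' xy).
Qed.

#[local] Instance vb_eq_cons n : Proper (eq ==> vb_eq n ==> vb_eq n) (@cons letter).
Proof. by move=> l _ <- x y xy; apply: (@vb_eq_cat n [:: l] [:: l]); [apply: vbe_refl|]. Qed.

(** The free tail [w], here and in the rules below, lets a relation be rewritten in the middle of a
    word; the prefix is handled by the morphism instances. *)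
Lemma vb_base_eq n x y w : vb_base n x y -> vb_eq n (x ++ w) (y ++ w).
Proof. exact: (@vbe_step n [::]). Qed.

Lemma flipK : involutive flip.
Proof. by case=> r i p; rewrite /flip /= negbK. Qed.

Lemma winv_cat u v : winv (u ++ v) = winv v ++ winv u.
Proof. by rewrite /winv map_cat rev_cat. Qed.

Lemma winvK : involutive winv.
Proof. by move=> w; rewrite /winv map_rev revK mapK //; apply: flipK. Qed.

Lemma valid_cat n u v : valid_word n (u ++ v) = valid_word n u && valid_word n v.
Proof. exact: all_cat. Qed.

Lemma valid_winv n w : valid_word n (winv w) = valid_word n w.
Proof. by rewrite /valid_word /winv all_rev all_map. Qed.

Lemma winv_cons l w : winv (l :: w) = winv w ++ [:: flip l].
Proof. by rewrite /winv /= rev_cons cats1. Qed.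

Lemma vb_mulV n u w : valid_word n u -> vb_eq n (u ++ winv u ++ w) w.
Proof.
elim: u w => [|l u IH] w; first by move=> _; apply: vbe_refl.
case/andP=> lv uv; rewrite winv_cons cat_cons -catA IH // cat_cons.
by apply: (@vb_base_eq n [:: l; flip l] [::]); apply: vb_cancel.
Qed.

Lemma vb_mulVr n u w : valid_word n u -> vb_eq n (winv u ++ u ++ w) w.
Proof. by move=> uv; have := @vb_mulV n (winv u) w; rewrite winvK valid_winv; apply. Qed.

Lemma vb_rho2 n k w : 0 < k < n -> vb_eq n (rho k :: rho k :: w) w.
Proof. by move=> kn; apply: (@vb_base_eq n [:: _; _] [::]); apply: vb_rr1. Qed.

Lemma vb_rhoi n k w : 0 < k < n -> vb_eq n (rhoi k :: w) (rho k :: w).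
Proof.
move=> kn; rewrite -{1}(vb_rho2 (rhoi k :: w) kn).
by apply: vb_eq_cons => //; apply: (@vb_mulV n [:: rho k]); rewrite /= /valid_letter /= kn.
Qed.

Lemma vb_sigsigi n k w : 0 < k < n -> vb_eq n (sig k :: sigi k :: w) w.
Proof. by move=> kn; apply: (@vb_mulV n [:: sig k]); rewrite /= /valid_letter /= kn. Qed.

Lemma vb_sigisig n k w : 0 < k < n -> vb_eq n (sigi k :: sig k :: w) w.
Proof. by move=> kn; apply: (@vb_mulV n [:: sigi k]); rewrite /= /valid_letter /= kn. Qed.

Lemma vb_rho_comm n j k w : 0 < j < n -> 0 < k < n -> (j.+1 < k) || (k.+1 < j) ->
  vb_eq n (rho k :: rho j :: w) (rho j :: rho k :: w).
Proof. by move=> jn kn jk; apply: (@vb_base_eq n [:: _; _] [:: _; _]); apply: vb_rr => //; lia. Qed.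

Lemma vb_rho_braid n i w : 0 < i -> i.+1 < n ->
  vb_eq n (rho i :: rho i.+1 :: rho i :: w) (rho i.+1 :: rho i :: rho i.+1 :: w).
Proof. by move=> i0 iin; apply: (@vb_base_eq n [:: _; _; _] [:: _; _; _]); apply: vb_rrr. Qed.

Lemma vb_rho_sigi_comm n j k w : 0 < j < n -> 0 < k < n -> (j.+1 < k) || (k.+1 < j) ->
  vb_eq n (rho k :: sigi j :: w) (sigi j :: rho k :: w).
Proof.
move=> jn kn jk; rewrite -{2}(vb_sigsigi w jn).
have E v : vb_eq n (sig j :: rho k :: v) (rho k :: sig j :: v).
  by apply: (@vb_base_eq n [:: _; _] [:: _; _]); apply: vb_sr => //; lia.
by rewrite -E vb_sigisig //; apply: vbe_refl.
Qed.

(** This is the mixed relation inverted in the sigma letters, with a rho moved across each side; it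
    makes the lambda with shifted indices agree. *)
Lemma vb_rho_sigi_shift n i w : 0 < i -> i.+1 < n ->
  vb_eq n (rho i :: sigi i.+1 :: rho i :: w) (rho i.+1 :: sigi i :: rho i.+1 :: w).
Proof.
move=> i0 iin.
have E v : vb_eq n (rho i :: rho i.+1 :: sig i :: v) (sig i.+1 :: rho i :: rho i.+1 :: v).
  by apply: (@vb_base_eq n [:: _; _; _] [:: _; _; _]); apply: vb_rrs.
rewrite -{1}(@vb_rho2 n i.+1 w) // -{1}(@vb_sigsigi n i (rho i.+1 :: w)); last lia.
by rewrite E vb_sigisig // vb_rho2; [apply: vbe_refl|lia].
Qed.

(** * Conjugation of the lambda by the rho *)

Definition rho_swaps (n k : nat) (x y : word) : Prop :=
  vb_eq n (rho k :: x) (y ++ [:: rho k]).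

Lemma rho_swaps_tail n k x y w : rho_swaps n k x y ->
  vb_eq n (rho k :: x ++ w) (y ++ rho k :: w).
Proof. by move=> xy; rewrite -cat_cons xy -catA; apply: vbe_refl. Qed.

(** As rho_k is an involution, [rho_swaps n k x y] says that conjugation by rho_k takes [x] to [y];
    its one-sided form serves to move rho_k to the right through a word. *)
Lemma rho_swaps_conj n k x y : 0 < k < n -> vb_eq n (rho k :: x ++ [:: rho k]) y ->
  rho_swaps n k x y.
Proof. by move=> kn xy; rewrite /rho_swaps -xy /= -catA /= vb_rho2 // cats0; apply: vbe_refl. Qed.

Lemma rho_swaps_conjE n k x y : 0 < k < n -> rho_swaps n k x y ->
  vb_eq n (rho k :: x ++ [:: rho k]) y.
Proof. by move=> kn xy; rewrite (rho_swaps_tail _ xy) vb_rho2 // cats0; apply: vbe_refl. Qed.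

Lemma rho_swaps_sym n k x y : 0 < k < n -> rho_swaps n k x y -> rho_swaps n k y x.
Proof.
move=> kn xy; rewrite /rho_swaps -(rho_swaps_conjE kn xy) vb_rho2 //.
exact: vbe_refl.
Qed.

(* Both [lambda i j] ([o = true]) and [lambda j i] ([o = false]), for [i < j]. *)
Definition olambda (o : bool) (i j : nat) : word :=
  if o then lambda i j else lambda j i.

Lemma olambda1 o i :
  olambda o i i.+1 = if o then [:: rho i; sigi i] else [:: sigi i; rho i].
Proof.
case: o; rewrite /olambda /lambda ?ltnSn ?ltnNge ?leqnSn /= /rho_chain /=;
  by rewrite subnn.
Qed.

(** Peels the outermost rho off the chain on both sides; the lemmas below induct on [j] through this
    recursion. *)
Lemma olambdaS n o i j : 0 < i -> i < j -> j < n ->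
  vb_eq n (olambda o i j.+1) (rho j :: olambda o i j ++ [:: rho j]).
Proof.
(* [winv] spells the right half of the chain with inverse letters, so the last rho is inverted first
   and the two words become literally equal. *)
move=> i0 ij jn; rewrite -(@vb_rhoi n j [::]); last lia.
suff -> : olambda o i j.+1 = rho j :: olambda o i j ++ [:: rhoi j] by apply: vbe_refl.
have C : rho_chain i j.+1 = rho j :: rho_chain i j.
  rewrite /rho_chain (_ : j.+1.-1 - i = (j.-1 - i).+1); last lia.
  by rewrite -[(j.-1 - i).+1]addn1 iotaD rev_cat map_cat (_ : i.+1 + _ = j) //; lia.
by case: o; rewrite /olambda /lambda; [have -> : i < j.+1 by lia|have -> : (j.+1 < i) = false by lia];
  [have -> : i < j by lia|have -> : (j < i) = false by lia];
  rewrite C winv_cons -!catA.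
Qed.

Lemma rho_olambda_far n o i j k : 0 < i -> i < j <= n -> 0 < k < n ->
  (k.+1 < i) || (j < k) -> rho_swaps n k (olambda o i j) (olambda o i j).
Proof.
move=> i0; elim: j => [|j IH] // ijn kn kij.
have [ij|ij] := eqVneq i j.
  rewrite -ij olambda1 /rho_swaps /=.
  have [rC sC] : (forall w, vb_eq n (rho k :: rho i :: w) (rho i :: rho k :: w)) /\
      (forall w, vb_eq n (rho k :: sigi i :: w) (sigi i :: rho k :: w)).
    by split=> w; [apply: vb_rho_comm|apply: vb_rho_sigi_comm]; lia.
  by case: o {IH}; rewrite /= ?rC sC ?rC; apply: vbe_refl.
apply: rho_swaps_conj => //; rewrite {1}olambdaS; try lia.
rewrite /= -catA /= vb_rho_comm; try lia.
rewrite rho_swaps_tail; last by apply: IH; lia.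
rewrite vb_rho_comm ?vb_rho2 ?olambdaS; try lia.
exact: vbe_refl.
Qed.

Lemma rho_olambda_flip n o i : 0 < i < n ->
  rho_swaps n i (olambda o i i.+1) (olambda (~~ o) i i.+1).
Proof.
move=> iin; apply: rho_swaps_conj => //; rewrite !olambda1.
by case: o; rewrite /= vb_rho2 //; apply: vbe_refl.
Qed.

Lemma rho_olambda_top n o i j : 0 < i -> i < j -> j < n ->
  rho_swaps n j (olambda o i j) (olambda o i j.+1).
Proof.
move=> i0 ij jn; apply: rho_swaps_conj; first lia.
by rewrite olambdaS //; apply: vbe_refl.
Qed.

Lemma rho_olambda_bottom n o i j : 0 < i -> i.+1 < j <= n ->
  rho_swaps n i (olambda o i.+1 j) (olambda o i j).
Proof.
move=> i0; elim: j => [|j IH] // ijn.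
apply: rho_swaps_conj; first lia.
have [ij|ij] := eqVneq i.+1 j.
  rewrite -ij (@olambdaS n o i) ?olambda1; try lia.
  (* In both orientations a pair rho_i rho_i is inserted next to sigma_{i+1}^{-1}, so that the shift
     relation applies to it and the braid relation to the remaining rho. *)
  case: o {IH} => /=.
    rewrite -(@vb_rho2 n i [:: sigi _; _]); last lia.
    rewrite vb_rho_sigi_shift ?vb_rho_braid //; try lia.
    by rewrite vb_rho2; [apply: vbe_refl | lia].
  rewrite -{1}(@vb_rho2 n i [:: rho i.+1; rho i]); last lia.
  rewrite vb_rho_sigi_shift ?vb_rho_braid //; try lia.
  by rewrite vb_rho2; [apply: vbe_refl | lia].
rewrite {1}olambdaS; try lia.
rewrite /= -catA /= vb_rho_comm; try lia.
rewrite rho_swaps_tail; last by apply: IH; lia.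
rewrite vb_rho_comm ?vb_rho2 ?olambdaS; try lia.
exact: vbe_refl.
Qed.

(** In the base case the braid relation for rho_{k+1} rho_k turns the incoming rho_k into rho_{k+1},
    which lies beyond the indices i, k of the inner lambda and commutes with it. *)
Lemma rho_olambda_mid n o i j k : 0 < i -> i < k -> k.+1 < j <= n ->
  rho_swaps n k (olambda o i j) (olambda o i j).
Proof.
move=> i0 ik; elim: j => [|j IH] // kjn.
have [kj|kj] := eqVneq k.+1 j.
  rewrite -kj in kjn *; rewrite /rho_swaps !olambdaS; try lia.
  rewrite /= -!catA /= vb_rho_braid; try lia.
  rewrite rho_swaps_tail; last by apply: rho_olambda_far; lia.
  by rewrite -vb_rho_braid; [apply: vbe_refl|lia|lia].
rewrite /rho_swaps !olambdaS; try lia.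
rewrite vb_rho_comm; try lia.
rewrite rho_swaps_tail; last by apply: IH; lia.
by rewrite /= -catA /= vb_rho_comm; [apply: vbe_refl|lia|lia|lia].
Qed.

(** Conjugation by rho_k applies the transposition of k and k+1 to both indices. The indices move
    only when k is one of i-1, i, j-1, j, and each such case is one of the lemmas above or its
    reverse. *)
Lemma rho_lambda n k a b : 0 < k < n -> 0 < a <= n -> 0 < b <= n -> a != b ->
  exists a' b', [/\ 0 < a' <= n, 0 < b' <= n, a' != b' &
    rho_swaps n k (lambda a b) (lambda a' b')].
Proof.
move=> kn.
suff H o i j : 0 < i -> i < j <= n -> exists o' i' j',
    [/\ 0 < i', i' < j' <= n & rho_swaps n k (olambda o i j) (olambda o' i' j')].
  move=> an bn; rewrite neq_ltn => /orP[ab|ab].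
    have [||o [i [j [i0 ij E]]]] := H true a b; try lia.
    by case: o E => E; [exists i, j|exists j, i]; split=> //; lia.
  have [||o [i [j [i0 ij E]]]] := H false b a; try lia.
  by case: o E => E; [exists i, j|exists j, i]; split=> //; lia.
move=> i0 ijn.
have [far|] := boolP ((k.+1 < i) || (j < k)).
  by exists o, i, j; split=> //; apply: rho_olambda_far.
have [kj|kj] := eqVneq j k.
  rewrite -kj in kn *; exists o, i, j.+1.
  by split; [|lia|apply: rho_olambda_top; lia].
have [ki|ki] := eqVneq k.+1 i.
  exists o, k, j; rewrite -ki in ijn *.
  by split; [lia|lia|apply: rho_olambda_bottom; lia].
have [ki'|ki'] := eqVneq i k => ?.
  rewrite -ki'; rewrite -ki' in kn; have [ij|ij] := eqVneq i.+1 j.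
    rewrite -ij; exists (~~ o), i, i.+1.
    by split; [|lia|apply: rho_olambda_flip].
  exists o, i.+1, j; split; [by []|lia|].
  by apply: rho_swaps_sym => //; apply: rho_olambda_bottom; lia.
have [kj'|kj'] := eqVneq k.+1 j.
  exists o, i, k; rewrite -kj'; split; [by []|lia|].
  by apply: rho_swaps_sym => //; apply: rho_olambda_top; lia.
by exists o, i, j; split=> //; apply: rho_olambda_mid; lia.
Qed.

Lemma rho_word_lambda n r a b :
  gen_below n r -> 0 < a <= n -> 0 < b <= n -> a != b ->
  exists a' b', [/\ 0 < a' <= n, 0 < b' <= n, a' != b' &
    vb_eq n (map rho r ++ lambda a b) (lambda a' b' ++ map rho r)].
Proof.
move=> + an bn ab; elim: r => [|k r IH].
  by exists a, b; split=> //; rewrite cats0; apply: vbe_refl.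
case/andP=> kn /IH[a' [b' [an' bn' ab' E]]].
have [a2 [b2 [an2 bn2 ab2 E2]]] := rho_lambda kn an' bn' ab'.
exists a2, b2; split=> //; rewrite map_cons cat_cons E (rho_swaps_tail _ E2).
exact: vbe_refl.
Qed.

(** * Images in S_n under the two homomorphisms *)

Lemma iota1_cat n u v : iota1 n (u ++ v) = (iota1 n u * iota1 n v)%g.
Proof. exact: big_cat. Qed.

Lemma iota2_cat n u v : iota2 n (u ++ v) = (iota2 n u * iota2 n v)%g.
Proof. exact: big_cat. Qed.

Lemma iota1_cons n l w : iota1 n (l :: w) = (iota1_letter n l * iota1 n w)%g.
Proof. exact: big_cons. Qed.

Lemma iota2_cons n l w : iota2 n (l :: w) = (iota2_letter n l * iota2 n w)%g.
Proof. exact: big_cons. Qed.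

Lemma iota1_nil n : iota1 n [::] = 1%g.
Proof. exact: big_nil. Qed.

Lemma iota2_nil n : iota2 n [::] = 1%g.
Proof. exact: big_nil. Qed.

Lemma iota1_flip n l : iota1_letter n (flip l) = ((iota1_letter n l)^-1)%g.
Proof. by case: l => [r i []]; rewrite /iota1_letter /= ?invgK. Qed.

Lemma iota2_flip n l : iota2_letter n (flip l) = ((iota2_letter n l)^-1)%g.
Proof. by rewrite /iota2_letter; case: l => [[] i p] /=; rewrite ?invg1 // -iota1_flip. Qed.

Lemma iota1_winv n w : iota1 n (winv w) = ((iota1 n w)^-1)%g.
Proof.
elim: w => [|l w IH]; first by rewrite iota1_nil invg1.
by rewrite winv_cons iota1_cat IH !iota1_cons iota1_nil mulg1 iota1_flip invMg.
Qed.

Lemma iota2_winv n w : iota2 n (winv w) = ((iota2 n w)^-1)%g.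
Proof.
elim: w => [|l w IH]; first by rewrite iota2_nil invg1.
by rewrite winv_cons iota2_cat IH !iota2_cons iota2_nil mulg1 iota2_flip invMg.
Qed.

(** Both maps are well defined on VB_n. The mixed relation becomes the braid relation under [iota1],
    while under [iota2] its two sides become the same product. *)
Lemma iota_vb_eq n u v : vb_eq n u v -> iota1 n u = iota1 n v /\ iota2 n u = iota2 n v.
Proof.
elim=> // [x u' v' y|u' v' _ [-> ->]|u' v' x _ [-> ->] _ [-> ->]] //.
rewrite !iota1_cat !iota2_cat => b.
suff [-> ->] : iota1 n u' = iota1 n v' /\ iota2 n u' = iota2 n v' by [].
have C i j : 0 < i < n -> 0 < j < n -> i + 2 <= j \/ j + 2 <= i ->
    (adj_tr n i * adj_tr n j = adj_tr n j * adj_tr n i)%g.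
  by move=> ? ? [] ij; [|symmetry]; apply: adj_tr_comm; lia.
case: b => [l _|i j iv jv ij|i j iv jv ij|i j iv jv ij|i i0 iin|i i0 iin|i iv|i i0 iin];
  rewrite !(iota1_cons, iota2_cons, iota1_nil, iota2_nil, mulg1, mul1g) ?iota1_flip ?iota2_flip
    ?mulgV // /iota2_letter /iota1_letter /= ?mulg1 ?mul1g ?mulgA ?adj_tr_braid ?adj_tr_sqr //;
  by rewrite C.
Qed.

Lemma iota1_lambda n a b : iota1 n (lambda a b) = 1%g.
Proof.
by rewrite /lambda; case: ifP => _; rewrite !iota1_cat iota1_winv !iota1_cons iota1_nil
  /iota1_letter /= mulg1 ?mulgV ?mulVg mul1g mulgV.
Qed.

Lemma transpC n a b : transp n a b = transp n b a.
Proof. exact: tpermC. Qed.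

Lemma transpMM n a b c : 0 < a <= n.+1 -> 0 < b <= n.+1 -> 0 < c <= n.+1 ->
  a != b -> a != c ->
  (transp n b c * (transp n a b * transp n b c) = transp n a c)%g.
Proof. by move=> *; rewrite -[X in (X * _)%g]tpermV -conjgE transpJ. Qed.

(** [iota2] kills the sigma letter, so only the transposition of its neighbouring rho survives,
    conjugated by the chain. *)
Lemma iota2_lambda n a b : 0 < a <= n.+1 -> 0 < b <= n.+1 -> a != b ->
  iota2 n.+1 (lambda a b) = transp n a b.
Proof.
suff H o i j : 0 < i -> i < j <= n.+1 -> iota2 n.+1 (olambda o i j) = transp n i j.
  move=> an bn; rewrite neq_ltn => /orP[ab|ab]; first by apply: (H true); lia.
  by rewrite transpC; apply: (H false); lia.
move=> i0; elim: j => [|j IH] // ijn.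
have [<-|ij] := eqVneq i j.
  by rewrite olambda1; case: o {IH}; rewrite !iota2_cons iota2_nil
    /iota2_letter /iota1_letter /= ?mulg1 ?mul1g.
have [ij' jn] : i < j /\ j < n.+1 by lia.
have [_ ->] := iota_vb_eq (olambdaS o i0 ij' jn).
rewrite iota2_cons iota2_cat iota2_cons iota2_nil mulg1 IH; last lia.
rewrite /iota2_letter /iota1_letter [is_rho _]/= [pos _]/= [idx _]/=.
by rewrite adj_trE transpMM //; lia.
Qed.

Lemma valid_lambda n a b : 0 < a <= n -> 0 < b <= n -> a != b ->
  valid_word n (lambda a b).
Proof.
have V i j : 0 < i -> i < j <= n -> valid_word n (rho_chain i j).
  move=> i0 ij; rewrite /valid_word all_map all_rev; apply/allP => k.
  by rewrite mem_iota /valid_letter /=; lia.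
move=> an bn; rewrite neq_ltn /lambda => /orP[ab|ab].
  by rewrite ab !valid_cat valid_winv V /= /valid_letter /=; lia.
have -> : (a < b) = false by lia.
by rewrite !valid_cat valid_winv V /= /valid_letter /=; lia.
Qed.

Lemma in_VP_lambda n a b : 0 < a <= n -> 0 < b <= n -> a != b ->
  in_VP n (lambda a b).
Proof. by move=> *; split; [apply: valid_lambda|apply: iota1_lambda]. Qed.

Lemma in_VP_cat n u v : in_VP n u -> in_VP n v -> in_VP n (u ++ v).
Proof.
by case=> uv u1 [vv v1]; split; rewrite ?valid_cat ?uv // iota1_cat u1 v1 mulg1.
Qed.

Lemma in_VP_winv n u : in_VP n u -> in_VP n (winv u).
Proof. by case=> uv u1; split; rewrite ?valid_winv // iota1_winv u1 invg1. Qed.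

Lemma in_VP_nil n : in_VP n [::].
Proof. by split=> //; apply: iota1_nil. Qed.

Lemma G_gen_iota n g : G_gen n g -> iota1 n g = 1%g /\ iota2 n g = 1%g.
Proof.
move=> Gg; split.
  by case: Gg => *; rewrite !iota1_cat ?iota1_winv !iota1_lambda ?invg1 !mulg1.
case: n Gg => [|n] Gg; first by case: Gg => *; lia.
have inv a b : ((transp n a b)^-1 = transp n a b)%g by apply: tpermV.
case: Gg => [s t s1 st tn|s t s1 st tn|s t q r s1 st tn q1 qr rn pos|t s r r1 rs st tn|t s r r1 rs st tn];
  rewrite !iota2_cat ?iota2_winv !iota2_lambda ?inv; try lia; rewrite ?mulgA.
- by rewrite transpC tperm2.
- by rewrite tperm2.
(* A positive product has no zero factor, so the pairs {s, t} and {q, r} are disjoint and their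
   transpositions commute. *)
- have neq (x y : nat) : x = y -> (x%:Z - y%:Z = 0)%R by move=> ->; rewrite GRing.subrr.
  have tr : t != r by apply/eqP => /neq E; rewrite E !GRing.mul0r in pos.
  have tq : t != q by apply/eqP => /neq E; rewrite E GRing.mulr0 !GRing.mul0r in pos.
  have sr : s != r by apply/eqP => /neq E; rewrite E GRing.mulr0 !GRing.mul0r in pos.
  have sq : s != q by apply/eqP => /neq E; rewrite E !GRing.mulr0 in pos.
  have C : (transp n t s * transp n r q = transp n r q * transp n t s)%g.
    by rewrite [RHS]conjgC /transp tpermJ !tpermD // inord_eq; lia.
  by rewrite C -(mulgA (transp n r q)) tperm2 mulg1 tperm2.
- by rewrite (transpC _ t s) (transpC _ s r) -(mulgA (transp n s t)) transpMM ?(transpC _ r t) ?tperm2 //; lia.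
- by rewrite -!mulgA (mulgA (transp n s r)) (transpC _ s r) -mulgA transpMM ?tperm2 //; lia.
Qed.

Lemma ncl_G_iota n u : ncl_G n u -> iota1 n u = 1%g /\ iota2 n u = 1%g.
Proof.
elim=> {u} [g /G_gen_iota|||||] //.
- by rewrite iota1_nil iota2_nil.
- by move=> u v _ [u1 u2] _ [v1 v2]; rewrite iota1_cat iota2_cat u1 u2 v1 v2 !mulg1.
- by move=> u _ [u1 u2]; rewrite iota1_winv iota2_winv u1 u2 !invg1.
- move=> x u _ _ [u1 u2].
  by rewrite !iota1_cat !iota2_cat iota1_winv iota2_winv u1 u2 !mul1g !mulgV.
- by move=> u v /iota_vb_eq[-> ->] _ [].
Qed.

(** * Congruence modulo the normal closure of G *)

Definition eq_mod (n : nat) (u v : word) : Prop := ncl_G n (u ++ winv v).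

Lemma eq_mod_sym n u v : eq_mod n u v -> eq_mod n v u.
Proof. by move/ncl_inv; rewrite winv_cat winvK. Qed.

Lemma eq_mod_refl n u : valid_word n u -> eq_mod n u u.
Proof.
move=> uv; apply: ncl_eq (ncl_one n).
by have /vbe_sym := vb_mulV [::] uv; rewrite cats0.
Qed.

(** Validity of the middle word allows it to cancel against its inverse, as free cancellation is
    available for valid letters only. *)
Lemma eq_mod_trans n u v w : valid_word n v ->
  eq_mod n u v -> eq_mod n v w -> eq_mod n u w.
Proof.
move=> vv uv vw; apply: ncl_eq (ncl_mul uv vw).
by rewrite -catA vb_mulVr //; apply: vbe_refl.
Qed.

(** The quotient of the products is u (u' v'^{-1}) u^{-1} times u v^{-1}. The conjugator [u] has to
    lie in VP_n, where the normal closure is taken. *)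
Lemma eq_mod_cat n u v u' v' : in_VP n u ->
  eq_mod n u v -> eq_mod n u' v' -> eq_mod n (u ++ u') (v ++ v').
Proof.
move=> uP uv /(ncl_conj uP) uv'; apply: ncl_eq (ncl_mul uv' uv).
rewrite winv_cat -!catA vb_mulVr; last by case: uP.
exact: vbe_refl.
Qed.

Lemma eq_mod_nil n u : eq_mod n u [::] <-> ncl_G n u.
Proof. by rewrite /eq_mod cats0. Qed.

(* Out-of-range indices give the empty word, so that every such word lies
   in VP_n. *)
Definition ell (n i : nat) : word := if 0 < i < n then lambda i.+1 i else [::].
Definition ell_word (n : nat) (s : seq nat) : word := flatten (map (ell n) s).

Lemma ell_word_cat n s t : ell_word n (s ++ t) = ell_word n s ++ ell_word n t.
Proof. by rewrite /ell_word map_cat flatten_cat. Qed.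

Lemma ellE n i : 0 < i < n -> ell n i = lambda i.+1 i.
Proof. by rewrite /ell => ->. Qed.

Lemma in_VP_ell n i : in_VP n (ell n i).
Proof.
by rewrite /ell; case: ifP => iv; [apply: in_VP_lambda; lia|apply: in_VP_nil].
Qed.

Lemma in_VP_ell_word n s : in_VP n (ell_word n s).
Proof.
elim: s => [|i s IH]; first exact: in_VP_nil.
by apply: in_VP_cat => //; apply: in_VP_ell.
Qed.

(** The relators [G4] and [G5] give ab = ca and ab = bc modulo G, hence bab = bca = aba. *)
Lemma ell_braid n i : 0 < i -> i.+1 < n ->
  eq_mod n (ell n i ++ ell n i.+1 ++ ell n i) (ell n i.+1 ++ ell n i ++ ell n i.+1).
Proof.
move=> i0 iin; rewrite !ellE; try lia.
set a := lambda i.+2 _; set b := lambda i.+1 i; set c := lambda i.+2 i.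
have [aP bP cP] : [/\ in_VP n a, in_VP n b & in_VP n c].
  by split; apply: in_VP_lambda; lia.
have ab_ca : eq_mod n (a ++ b) (c ++ a).
  by rewrite /eq_mod winv_cat -catA; apply/ncl_gen/G4; lia.
have ab_bc : eq_mod n (a ++ b) (b ++ c).
  by rewrite /eq_mod winv_cat -catA; apply/ncl_gen/G5; lia.
have V := fun u v uP vP => (@in_VP_cat n u v uP vP).
have R u : in_VP n u -> eq_mod n u u by case=> uv _; apply: eq_mod_refl.
apply: (@eq_mod_trans _ _ (b ++ c ++ a)).
- by have [] := V _ _ bP (V _ _ cP aP).
- by apply: eq_mod_cat => //; apply: R.
rewrite !catA; apply: eq_mod_cat; [exact: V | exact: eq_mod_sym | exact: R].
Qed.

Lemma cox_eq_mod n s t : cox_eq n s t -> eq_mod n (ell_word n s) (ell_word n t).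
Proof.
have V u : valid_word n (ell_word n u) by case: (in_VP_ell_word n u).
elim=> {s t} [s|s t _|s t u _ st _ tu|s t s' t' _ st _ st'|i iv|i j i0 ij jn|i i0 iin].
- exact: eq_mod_refl.
- exact: eq_mod_sym.
- exact: eq_mod_trans st tu.
- by rewrite !ell_word_cat; apply: eq_mod_cat => //; apply: in_VP_ell_word.
- by apply/eq_mod_nil; rewrite /ell_word /= cats0 ellE //; apply/ncl_gen/G2; lia.
- rewrite /ell_word /= !cats0 !ellE; try lia.
  rewrite /eq_mod winv_cat -catA; apply/ncl_gen/G3; try lia.
  (* Since i + 1 < j, all four differences are negative and their product is positive. *)
  by rewrite -GRing.mulrA Num.Theory.mulr_gt0 // Num.Theory.nmulr_rgt0; lia.
- by rewrite /ell_word /= !cats0; apply: ell_braid.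
Qed.

(** [G1] reduces to a decreasing index pair. With l = lambda_{t+1,t}, [G4] gives l lambda_{t,r} =
    lambda_{t+1,r} l, and l^2 = 1 by [G2]; so lambda_{t+1,r} is l lambda_{t,r} l, which explains the
    word [t :: rcons s t]. *)
Lemma lambda_eq_ell n a b : 0 < a <= n -> 0 < b <= n -> a != b ->
  exists2 s, gen_below n s & eq_mod n (lambda a b) (ell_word n s).
Proof.
have V a' b' : 0 < a' <= n -> 0 < b' <= n -> a' != b' -> valid_word n (lambda a' b').
  exact: valid_lambda.
suff H t r : 0 < r -> r < t <= n ->
    exists2 s, gen_below n s & eq_mod n (lambda t r) (ell_word n s).
  move=> an bn; rewrite neq_ltn => /orP[ab|ab]; last by apply: H; lia.
  have [||s sn E] := H b a; try lia; exists s => //.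
  by apply: eq_mod_trans E; [apply: V; lia|apply/ncl_gen/G1; lia].
move=> r0; elim: t => [|t IH] // rtn.
have [<-|rt] := eqVneq r t.
  exists [:: r]; first by rewrite /gen_below /=; lia.
  by rewrite /ell_word /= cats0 ellE; [apply: eq_mod_refl; apply: V; lia|lia].
have [|s sn E] := IH; first lia.
exists (t :: rcons s t).
  by rewrite /gen_below /= all_rcons; apply/and3P; split=> //; lia.
rewrite -cat1s -cats1 !ell_word_cat /ell_word /= !cats0 ellE -/(ell_word n s); last lia.
set l := lambda t.+1 t.
have lP : in_VP n l by apply: in_VP_lambda; lia.
have lv : valid_word n l by case: lP.
have trP : in_VP n (lambda t r) by apply: in_VP_lambda; lia.
have ll : eq_mod n (l ++ l) [::] by apply/eq_mod_nil/ncl_gen/G2; lia.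
have lP' : in_VP n (lambda t.+1 r) by apply: in_VP_lambda; lia.
apply: (@eq_mod_trans _ _ (lambda t.+1 r ++ l ++ l)).
- by rewrite !valid_cat lv V; lia.
- rewrite -{1}[lambda t.+1 r]cats0; apply: eq_mod_cat => //; last exact: eq_mod_sym.
  by apply: eq_mod_refl; case: lP'.
rewrite !catA; apply: (@eq_mod_trans _ _ ((l ++ lambda t r) ++ l)).
- by rewrite !valid_cat lv V; lia.
- apply: eq_mod_cat; [exact: in_VP_cat| |exact: eq_mod_refl].
  by apply: eq_mod_sym; rewrite /eq_mod winv_cat -catA; apply/ncl_gen/G4; lia.
apply: eq_mod_cat; [exact: in_VP_cat| |exact: eq_mod_refl].
by apply: eq_mod_cat => //; apply: eq_mod_refl.
Qed.

Lemma lambda_sqr n a b : 0 < a <= n -> 0 < b <= n -> a != b ->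
  ncl_G n (lambda a b ++ lambda a b).
Proof.
move=> an bn; rewrite neq_ltn => /orP[ab|ab]; last by apply/ncl_gen/G2; lia.
have baP : in_VP n (lambda b a) by apply: in_VP_lambda; lia.
have abP : in_VP n (lambda a b) by apply: in_VP_lambda; lia.
have E : eq_mod n (lambda a b) (lambda b a) by apply/ncl_gen/G1; lia.
apply/eq_mod_nil; apply: (@eq_mod_trans _ _ (lambda b a ++ lambda b a)).
- by have [] := in_VP_cat baP baP.
- exact: eq_mod_cat.
by apply/eq_mod_nil/ncl_gen/G2; lia.
Qed.

Lemma winv_lambda_eq_ell n a b : 0 < a <= n -> 0 < b <= n -> a != b ->
  exists2 s, gen_below n s & eq_mod n (winv (lambda a b)) (ell_word n s).
Proof.
move=> an bn ab; have [s sn E] := lambda_eq_ell an bn ab; exists s => //.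
apply: eq_mod_trans E; first exact: valid_lambda.
by apply: eq_mod_sym; rewrite /eq_mod winvK; apply: lambda_sqr.
Qed.

Lemma rho_word_winv_lambda n r a b :
  gen_below n r -> 0 < a <= n -> 0 < b <= n -> a != b ->
  exists a' b', [/\ 0 < a' <= n, 0 < b' <= n, a' != b' &
    vb_eq n (map rho r ++ winv (lambda a b)) (winv (lambda a' b') ++ map rho r)].
Proof.
move=> rn an bn ab; have [a' [b' [an' bn' ab' E]]] := rho_word_lambda rn an bn ab.
exists a', b'; split=> //.
(* Inserting the new lambda and its inverse in front lets the rule for lambda itself be used from
   right to left. *)
rewrite -(vb_mulVr (map rho r ++ _) (valid_lambda an' bn' ab')).
rewrite (catA (lambda a' b')) -E -!catA.
have := vb_mulV [::] (valid_lambda an bn ab); rewrite cats0 => ->.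
rewrite cats0; exact: vbe_refl.
Qed.

(** * Factorization of words and the two inclusions *)

Lemma lambda_rho_factor n w : valid_word n w -> exists x s r,
  [/\ in_VP n x, gen_below n s, eq_mod n x (ell_word n s), gen_below n r &
      vb_eq n w (x ++ map rho r)].
Proof.
elim/last_ind: w => [|w l IH].
  exists [::], [::], [::]; split=> //; [exact: in_VP_nil|exact: ncl_one|exact: vbe_refl].
rewrite /valid_word all_rcons => /andP[lv /IH[x [s [r [xP sn xs rn E]]]]].
(* The new letter is y rho_i. Moving the rho prefix [r] to the right past [y] renames it to some
   [y'], which joins the pure part together with its own word in the lambda_{i+1,i}. *)
have step i y : 0 < i < n -> vb_eq n [:: l] (y ++ [:: rho i]) ->
    (exists y' t, [/\ in_VP n y', gen_below n t, eq_mod n y' (ell_word n t) &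
      vb_eq n (map rho r ++ y) (y' ++ map rho r)]) ->
    exists x s r, [/\ in_VP n x, gen_below n s, eq_mod n x (ell_word n s),
      gen_below n r & vb_eq n (rcons w l) (x ++ map rho r)].
  move=> iv ly [y' [t [yP tn yt E']]]; exists (x ++ y'), (s ++ t), (rcons r i).
  split.
  - exact: in_VP_cat.
  - by rewrite /gen_below all_cat; apply/andP.
  - by rewrite ell_word_cat; apply: eq_mod_cat.
  - by rewrite /gen_below all_rcons; apply/andP.
  rewrite -cats1 ly E map_rcons -cats1 -!catA (catA _ y) E' -!catA.
  exact: vbe_refl.
case: l lv step => [[] i p] lv step; rewrite /valid_letter /= in lv.
  apply: (step i [::]) => //.
    by case: p {step}; [apply: vbe_refl|apply: vb_rhoi].
  exists [::], [::]; split=> //; [exact: in_VP_nil|exact: ncl_one|].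
  by rewrite cats0; apply: vbe_refl.
have [iv i1v ii1] : [/\ 0 < i <= n, 0 < i.+1 <= n & i != i.+1] by split; lia.
have L1 : lambda i i.+1 = [:: rho i; sigi i] by apply: (olambda1 true).
have L2 : lambda i.+1 i = [:: sigi i; rho i] by apply: (olambda1 false).
(* Here sigma_i = lambda_{i,i+1}^{-1} rho_i and sigma_i^{-1} = lambda_{i+1,i} rho_i. *)
case: p step => step.
  apply: (step i (winv (lambda i i.+1))) => //.
    rewrite L1 /winv /= -[flip (rho i)]/(rhoi i) vb_rhoi // vb_rho2 //.
    exact: vbe_refl.
  have [a [b [av bv ab E']]] := rho_word_winv_lambda rn iv i1v ii1.
  have [t tn E2] := winv_lambda_eq_ell av bv ab.
  by exists (winv (lambda a b)), t; split=> //; apply/in_VP_winv/in_VP_lambda.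
rewrite eq_sym in ii1.
apply: (step i (lambda i.+1 i)) => //.
  by rewrite L2 /= vb_rho2 //; apply: vbe_refl.
have [a [b [av bv ab E']]] := rho_word_lambda rn i1v iv ii1.
have [t tn E2] := lambda_eq_ell av bv ab.
by exists (lambda a b), t; split=> //; apply: in_VP_lambda.
Qed.

Lemma iota1_rho_word n r : iota1 n (map rho r) = adj_prod n r.
Proof. by rewrite /iota1 big_map. Qed.

Lemma iota2_ell_word n s : gen_below n s -> iota2 n (ell_word n s) = adj_prod n s.
Proof.
case: n => [|n]; first by case: s => [|i s] /=; [rewrite iota2_nil /adj_prod big_nil|lia].
elim: s => [|i s IH] /=; first by rewrite iota2_nil /adj_prod big_nil.
case/andP=> iv sn; rewrite iota2_cat IH // ellE // iota2_lambda; try lia.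
by rewrite /adj_prod big_cons adj_trE transpC.
Qed.

Lemma cox_eq_rho_word n s t : cox_eq n s t -> vb_eq n (map rho s) (map rho t).
Proof.
elim=> {s t} [s|s t _|s t u _ st _|s t s' t' _ st _ st'|i iv|i j i0 ij jn|i i0 iin].
- exact: vbe_refl.
- exact: vbe_sym.
- exact: vbe_trans.
- by rewrite !map_cat st st'; apply: vbe_refl.
- exact: vb_rho2.
- by apply: vb_rho_comm; lia.
- exact: vb_rho_braid.
Qed.

Theorem theorem7 (n : nat) (w : word) :
  valid_word n w -> (ncl_G n w <-> in_VP n w /\ in_H n w).
Proof.
move=> wv; split=> [/ncl_G_iota[w1 w2]|[[_ w1] [_ w2]]]; first by split; split.
have [x [s [r [xP sn xs rn E]]]] := lambda_rho_factor wv.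
have [E1 E2] := iota_vb_eq E.
(* [iota1] kills both [w] and [x], so [r] spells the identity and its rho word is trivial already in
   VB_n. *)
have wx : vb_eq n w x.
  have r1 : adj_prod n r = 1%g.
    by move: E1; rewrite w1 iota1_cat iota1_rho_word; case: xP => _ ->; rewrite mul1g.
  have := cox_eq_rho_word (coxeter_presentation rn r1).
  by move=> r_nil; rewrite E r_nil cats0; apply: vbe_refl.
(* [iota2] kills the normal closure, so it takes equal values on [x] and on [ell_word n s]; the
   former is 1 because [w] lies in H_n. *)
have s1 : adj_prod n s = 1%g.
  have [_] := ncl_G_iota xs; rewrite iota2_cat iota2_winv iota2_ell_word //.
  by have [_ <-] := iota_vb_eq wx; rewrite w2 mul1g => /eqP; rewrite invg_eq1 => /eqP.
apply: ncl_eq (vbe_sym wx) _; apply/eq_mod_nil.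
apply: eq_mod_trans xs _; first by case: (in_VP_ell_word n s).
exact: (cox_eq_mod (coxeter_presentation sn s1)).
Qed.
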